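(* Let $\mathcal{C}$ be a small category with finite limits, equipped with an admissible class $\mathcal{M}$, with associated presheaf $M$. Let $\mathcal{F}=\{f_C:D_{f_C}\to C\}_{C\in\mathcal{C}}$ be a family of arrows in $\mathcal{C}$ such that for any arrow $g:C\to D$ and any $S_D\in\Omega(D)$, $$\{h\mid C_h=C,\ f_C\times h\in g^*(S_D)\}=\{h\mid C_h=C,\ f_D\times(gh)\in S_D\}.$$ Then the arrow $\alpha_{\mathcal{F}}:\Omega\to\Omega$ given by $$(\alpha_{\mathcal{F}})_C(S_C)=\{h\mid C_h=C,\ f_C\times h\in S_C\}\qquad(C\in\mathcal{C},\ S_C\in\Omega(C))$$ is an ($M$-)action preserving productive weak topology on $\widehat{\mathcal{C}}$. Furthermore, $\alpha_{\mathcal{F}}$ is a topology on $\widehat{\mathcal{C}}$ if for any $C\in\mathcal{C}$ the arrow $f_C$ is idempotent in $\mathcal{C}/C$. Conversely, if $\alpha_{\mathcal{F}}:\Omega\to\Omega$ is a topology on $\widehat{\mathcal{C}}$, then $$f_C\times h\in S_C\iff f_C^2\times h\in S_C$$ for any $C\in\mathcal{C}$, $S_C\in\Omega(C)$ and $h\in(\alpha_{\mathcal{F}})_C(S_C)$.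
   Context: $\widehat{\mathcal{C}}$ is the category of presheaves of sets on $\mathcal{C}$, with subobject classifier $\Omega$: $\Omega(C)$ is the set of sieves on $C$, and $g^*(S)=\{h\mid gh\in S\}$. For an arrow $f$, $D_f$ is its domain and $C_f$ its codomain. For arrows $f,g$ with codomain $C$, $f\times g$ denotes their product in the slice category $\mathcal{C}/C$, i.e. the diagonal of the pullback square of $f$ and $g$ (defined up to isomorphism over $C$). We write $f^2=f\times f$, and an arrow $f:A\to B$ is idempotent in $\mathcal{C}/B$ if $f^2=f$. An admissible class $\mathcal{M}$ on $\mathcal{C}$ is a family of subobjects (monics) of $\mathcal{C}$ which contains all identities, is closed under composition, and is closed under pullback along arbitrary arrows. It yields a subpresheaf $M$ of $\mathrm{Sub}_{\mathcal{C}}(-)$ by $M(C)=\mathcal{M}/C$, the set of subobjects of $C$ in $\mathcal{M}$, with arrows acting by pullback. $M$ is an internal commutative monoid with multiplication $f\times g$ and unit $\mathrm{id}_C$ at each $C$, and it acts on $\Omega$ by $S_C\cdot m=\{h\mid C_h=C,\ m\times h\in S_C\}$ for $S_C\in\Omega(C)$, $m\in M(C)$. A map $\phi:\Omega\to\Omega$ in $\widehat{\mathcal{C}}$ is action preserving if $\phi_C(S_C\cdot m)=\phi_C(S_C)\cdot m$ for all $C$, $S_C\in\Omega(C)$, $m\in M(C)$. A weak topology on $\widehat{\mathcal{C}}$ is a morphism $j:\Omega\to\Omega$ with $j\circ\mathrm{true}=\mathrm{true}$ and $j\circ\wedge\le\wedge\circ(j\times j)$; it is productive if $j\circ\wedge=\wedge\circ(j\times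 j)$. A topology is a morphism $j$ with $j\circ\mathrm{true}=\mathrm{true}$, $j\circ j=j$, $j\circ\wedge=\wedge\circ(j\times j)$. *)

(* Defs.v *)
From Stdlib Require Import List FinFun ClassicalEpsilon
  FunctionalExtensionality PropExtensionality.

Set Implicit Arguments.
Unset Strict Implicit.
Unset Printing Implicit Defensive.

Declare Scope cat_scope.
Delimit Scope cat_scope with cat.
Open Scope cat_scope.

(* Objects and arrows live in one universe and arrows are compared with [=]:
   these are small categories. *)
Record Category := {
  Ob :> Type;
  Hom : Ob -> Ob -> Type;
  idm : forall A, Hom A A;
  comp : forall A B D, Hom B D -> Hom A B -> Hom A D;
  comp_idl : forall A B (f : Hom A B), comp (idm B) f = f;
  comp_idr : forall A B (f : Hom A B), comp f (idm A) = f;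
  comp_assoc : forall A B D E (h : Hom D E) (g : Hom B D) (f : Hom A B),
    comp h (comp g f) = comp (comp h g) f
}.

Arguments Hom {_} _ _.
Arguments idm {_} _.
Arguments comp {_ _ _ _} _ _.

Notation "g ∘ f" := (comp g f) (at level 40, left associativity) : cat_scope.

Record Functor (J C : Category) := {
  fob :> J -> C;
  fmap : forall A B : J, Hom A B -> Hom (fob A) (fob B);
  fmap_id : forall A : J, fmap (idm A) = idm (fob A);
  fmap_comp : forall (A B D : J) (g : Hom B D) (f : Hom A B),
    fmap (g ∘ f) = fmap g ∘ fmap f
}.

Definition is_cone (J C : Category) (F : Functor J C) (X : C)
    (p : forall i : J, Hom X (F i)) : Prop :=
  forall (i k : J) (u : Hom i k), fmap F u ∘ p i = p k.

Definition is_limit (J C : Category) (F : Functor J C) (L : C)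
    (p : forall i : J, Hom L (F i)) : Prop :=
  is_cone p /\
  forall (X : C) (q : forall i : J, Hom X (F i)), is_cone q ->
    exists! t : Hom X L, forall i : J, p i ∘ t = q i.

Definition finite_category (J : Category) : Prop :=
  Finite J /\ forall i k : J, Finite (Hom i k).

Definition has_finite_limits (C : Category) : Prop :=
  forall (J : Category) (F : Functor J C), finite_category J ->
    exists (L : C) (p : forall i : J, Hom L (F i)), is_limit p.

Record FinLimCategory := {
  base_cat :> Category;
  finite_limits : has_finite_limits base_cat
}.

Definition monic (C : Category) (A B : C) (m : Hom A B) : Prop :=
  forall (X : C) (a b : Hom X A), m ∘ a = m ∘ b -> a = b.

(* [f] and [g] are isomorphic as objects of the slice category C/X. *)
Definition iso_over (C : Category) (X A B : C) (f : Hom A X) (g : Hom B X)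
    : Prop :=
  exists (u : Hom A B) (v : Hom B A),
    u ∘ v = idm B /\ v ∘ u = idm A /\ g ∘ u = f.

Definition is_pullback (C : Category) (A B X P : C) (f : Hom A X) (g : Hom B X)
    (p : Hom P A) (q : Hom P B) : Prop :=
  f ∘ p = g ∘ q /\
  forall (Y : C) (a : Hom Y A) (b : Hom Y B), f ∘ a = g ∘ b ->
    exists! t : Hom Y P, p ∘ t = a /\ q ∘ t = b.

Inductive cospan_ob : Set := cs_left | cs_right | cs_base.

Definition cospan_hom (i k : cospan_ob) : Set :=
  match i, k with
  | cs_left, cs_left | cs_right, cs_right | cs_base, cs_base
  | cs_left, cs_base | cs_right, cs_base => unit
  | _, _ => Empty_set
  end.

Definition cospan : Category.
Proof.
refine (@Build_Category cospan_ob cospan_hom _ _ _ _ _).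
Unshelve. 4: intros []; exact tt.
4: intros [] [] []; simpl; tauto.
all: repeat (intros []); try reflexivity; simpl in *; contradiction.
Defined.

Lemma cospan_finite : finite_category cospan.
Proof.
split.
- exists (cs_left :: cs_right :: cs_base :: nil); intros []; simpl; tauto.
- intros [] []; (exists (tt :: nil); intros []; simpl; tauto)
    || (exists nil; intros []).
Qed.

Definition cospan_fob (C : Category) (A B X : C) (i : cospan_ob) : C :=
  match i with cs_left => A | cs_right => B | cs_base => X end.

Definition cospan_fmap (C : Category) (A B X : C) (f : Hom A X) (g : Hom B X)
    (i k : cospan_ob) :
    cospan_hom i k -> Hom (cospan_fob A B X i) (cospan_fob A B X k) :=
  match i, k return
    cospan_hom i k -> Hom (cospan_fob A B X i) (cospan_fob A B X k) with
  | cs_left, cs_left => fun _ => idm A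
  | cs_right, cs_right => fun _ => idm B
  | cs_base, cs_base => fun _ => idm X
  | cs_left, cs_base => fun _ => f
  | cs_right, cs_base => fun _ => g
  | _, _ => fun u => match u : Empty_set with end
  end.

Definition cospan_functor (C : Category) (A B X : C) (f : Hom A X)
    (g : Hom B X) : Functor cospan C.
Proof.
refine (@Build_Functor cospan C (cospan_fob A B X)
  (fun i k => @cospan_fmap C A B X f g i k) _ _).
- intros []; reflexivity.
- intros [] [] [] [] []; simpl; rewrite ?comp_idl, ?comp_idr; reflexivity.
Defined.

Lemma pullback_exists (C : FinLimCategory) (A B X : C) (f : Hom A X)
    (g : Hom B X) :
  exists (P : C) (p : Hom P A) (q : Hom P B), is_pullback f g p q.
Proof.
destruct (finite_limits (cospan_functor f g) cospan_finite)
  as [L [p [Hc Hu]]].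
exists L, (p cs_left), (p cs_right); split.
- transitivity (p cs_base).
  + exact (Hc cs_left cs_base tt).
  + symmetry; exact (Hc cs_right cs_base tt).
- intros Y a b Hab.
  pose (q := fun i : cospan_ob =>
    match i return Hom Y (cospan_fob A B X i) with
    | cs_left => a | cs_right => b | cs_base => f ∘ a end).
  destruct (Hu Y q) as [t [Ht Hut]].
  + intros [] [] []; simpl; auto using comp_idl.
  + exists t; split.
    * split; [exact (Ht cs_left) | exact (Ht cs_right)].
    * intros t' [H1 H2]; apply Hut; intros []; simpl; auto.
      rewrite <- H1, comp_assoc; f_equal.
      symmetry; exact (Hc cs_left cs_base tt).
Qed.

Record Pullback (C : Category) (A B X : C) (f : Hom A X) (g : Hom B X) := {
  pb_ob : C;
  pb_fst : Hom pb_ob A;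
  pb_snd : Hom pb_ob B;
  pb_is_pullback : is_pullback f g pb_fst pb_snd
}.

Definition chosen_pullback (C : FinLimCategory) (A B X : C) (f : Hom A X)
    (g : Hom B X) : Pullback f g.
Proof.
refine (proj1_sig (constructive_indefinite_description (fun _ => True) _)).
destruct (pullback_exists f g) as [P [p [q H]]].
exists (Build_Pullback H); exact I.
Qed.

(* The product in C/X: the diagonal of a pullback square. The square is chosen;
   membership of the product in a sieve does not depend on the choice, a sieve
   being closed under precomposition. *)
Definition slice_prod (C : FinLimCategory) (A B X : C) (f : Hom A X)
    (g : Hom B X) : Hom (pb_ob (chosen_pullback f g)) X :=
  f ∘ pb_fst (chosen_pullback f g).

Notation "f × g" := (slice_prod f g) (at level 40, left associativity)
  : cat_scope.

(* [f × f] being defined up to isomorphism over [X], so is the equation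
   [f × f = f]. *)
Definition slice_idempotent (C : FinLimCategory) (A X : C) (f : Hom A X)
    : Prop :=
  iso_over (f × f) f.

(* [restr g x] is [g^*(x)]. *)
Record Presheaf (C : Category) := {
  sec :> C -> Type;
  restr : forall X Y : C, Hom Y X -> sec X -> sec Y;
  restr_id : forall (X : C) (x : sec X), restr (idm X) x = x;
  restr_comp : forall (X Y Z : C) (g : Hom Y X) (h : Hom Z Y) (x : sec X),
    restr (g ∘ h) x = restr h (restr g x)
}.

Record PshHom (C : Category) (F G : Presheaf C) := {
  app :> forall X : C, F X -> G X;
  natural : forall (X Y : C) (g : Hom Y X) (x : F X),
    app (restr g x) = restr g (app x)
}.

Lemma pshhom_ext (C : Category) (F G : Presheaf C) (a b : PshHom F G) :
  (forall (X : C) (x : F X), a X x = b X x) -> a = b.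
Proof.
destruct a as [a Ha], b as [b Hb]; simpl; intros H.
assert (E : a = b).
{ extensionality X; extensionality x; apply H. }
subst b; f_equal; apply proof_irrelevance.
Qed.

Definition psh_comp (C : Category) (F G H : Presheaf C) (b : PshHom G H)
    (a : PshHom F G) : PshHom F H.
Proof.
refine {| app := fun X x => b X (a X x) |}.
intros; rewrite !natural; reflexivity.
Defined.

Notation "b ⊚ a" := (psh_comp b a) (at level 40, left associativity)
  : cat_scope.

Definition psh_one (C : Category) : Presheaf C.
Proof.
refine {| sec := fun _ => unit; restr := fun _ _ _ x => x |}; reflexivity.
Defined.

Definition psh_prod (C : Category) (F G : Presheaf C) : Presheaf C.
Proof.
refine {| sec := fun X => (F X * G X)%type;
          restr := fun X Y g x => (restr g (fst x), restr g (snd x)) |}.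
- intros X [x y]; simpl; rewrite !restr_id; reflexivity.
- intros; simpl; rewrite !restr_comp; reflexivity.
Defined.

Definition psh_prod_map (C : Category) (F G F' G' : Presheaf C)
    (a : PshHom F F') (b : PshHom G G') :
  PshHom (psh_prod F G) (psh_prod F' G').
Proof.
refine (@Build_PshHom C (psh_prod F G) (psh_prod F' G')
  (fun X x => (a X (fst x), b X (snd x))) _).
intros; simpl; rewrite !natural; reflexivity.
Defined.

Record Sieve (C : Category) (X : C) := {
  mem :> forall A : C, Hom A X -> Prop;
  mem_closed : forall (A B : C) (h : Hom A X) (k : Hom B A),
    mem h -> mem (h ∘ k)
}.

Arguments mem {C X} _ {A} _.

Lemma sieve_ext (C : Category) (X : C) (S T : Sieve X) :
  (forall (A : C) (h : Hom A X), S A h <-> T A h) -> S = T.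
Proof.
destruct S as [S HS], T as [T HT]; simpl; intros H.
assert (E : S = T).
{ extensionality A; extensionality h; apply propositional_extensionality, H. }
subst T; f_equal; apply proof_irrelevance.
Qed.

Definition sieve_restr (C : Category) (X Y : C) (g : Hom Y X) (S : Sieve X)
    : Sieve Y.
Proof.
refine {| mem := fun A h => S A (g ∘ h) |}.
intros A B h k; rewrite comp_assoc; apply mem_closed.
Defined.

Definition Omega (C : Category) : Presheaf C.
Proof.
refine {| sec := @Sieve C; restr := @sieve_restr C |}.
- intros X S; apply sieve_ext; intros A h; simpl.
  rewrite comp_idl; tauto.
- intros X Y Z g h S; apply sieve_ext; intros A k; simpl.
  rewrite comp_assoc; tauto.
Defined.

Definition sieve_max (C : Category) (X : C) : Sieve X.
Proof. refine {| mem := fun _ _ => True |}; trivial. Defined.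

Definition sieve_meet (C : Category) (X : C) (S T : Sieve X) : Sieve X.
Proof.
refine {| mem := fun A h => S A h /\ T A h |}.
intros A B h k [H1 H2]; split; apply mem_closed; assumption.
Defined.

Definition psh_true (C : Category) : PshHom (psh_one C) (Omega C).
Proof.
refine (@Build_PshHom C (psh_one C) (Omega C) (fun X _ => sieve_max X) _).
intros; apply sieve_ext; simpl; tauto.
Defined.

Definition psh_meet (C : Category)
    : PshHom (psh_prod (Omega C) (Omega C)) (Omega C).
Proof.
refine (@Build_PshHom C (psh_prod (Omega C) (Omega C)) (Omega C)
  (fun X ST => sieve_meet (fst ST) (snd ST)) _).
intros; apply sieve_ext; simpl; tauto.
Defined.

Definition psh_le (C : Category) (F : Presheaf C) (a b : PshHom F (Omega C))
    : Prop :=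
  forall (X : C) (x : F X) (A : C) (h : Hom A X),
    mem (a X x) h -> mem (b X x) h.

Definition weak_topology (C : Category) (j : PshHom (Omega C) (Omega C))
    : Prop :=
  j ⊚ psh_true C = psh_true C /\
  psh_le (j ⊚ psh_meet C) (psh_meet C ⊚ psh_prod_map j j).

Definition productive_weak_topology (C : Category)
    (j : PshHom (Omega C) (Omega C)) : Prop :=
  weak_topology j /\ j ⊚ psh_meet C = psh_meet C ⊚ psh_prod_map j j.

Definition topology (C : Category) (j : PshHom (Omega C) (Omega C))
    : Prop :=
  j ⊚ psh_true C = psh_true C /\
  j ⊚ j = j /\
  j ⊚ psh_meet C = psh_meet C ⊚ psh_prod_map j j.

(* Closure under every pullback square makes the class closed under isomorphism
   over the codomain, so that it is indeed a class of subobjects. *)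
Record AdmissibleClass (C : Category) := {
  adm :> forall A X : C, Hom A X -> Prop;
  adm_monic : forall (A X : C) (m : Hom A X), adm m -> monic m;
  adm_id : forall X : C, adm (idm X);
  adm_comp : forall (A B X : C) (m : Hom B X) (n : Hom A B),
    adm m -> adm n -> adm (m ∘ n);
  adm_pullback : forall (A X Y P : C) (m : Hom A X) (g : Hom Y X)
      (p : Hom P A) (q : Hom P Y),
    adm m -> is_pullback m g p q -> adm q
}.

Arguments adm {C} _ {A X} _.

(* A subobject of [X] in [M], as the class of all arrows isomorphic over [X] to
   some arrow of [M]. *)
Record AdmSub (C : Category) (M : AdmissibleClass C) (X : C) := {
  represents : forall A : C, Hom A X -> Prop;
  adm_rep : exists (A : C) (m : Hom A X), adm M m /\
    forall (B : C) (n : Hom B X), represents n <-> iso_over n m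
}.

Arguments represents {C M X} _ {A} _.

Lemma admsub_ext (C : Category) (M : AdmissibleClass C) (X : C)
    (m n : AdmSub M X) :
  (forall (A : C) (h : Hom A X), represents m h <-> represents n h) -> m = n.
Proof.
destruct m as [m Hm], n as [n Hn]; simpl; intros H.
assert (E : m = n).
{ extensionality A; extensionality h; apply propositional_extensionality, H. }
subst n; f_equal; apply proof_irrelevance.
Qed.

Lemma iso_over_refl (C : Category) (A X : C) (f : Hom A X) : iso_over f f.
Proof. exists (idm A), (idm A); rewrite comp_idl, comp_idr; auto. Qed.

Lemma iso_over_sym (C : Category) (A B X : C) (f : Hom A X) (g : Hom B X) :
  iso_over f g -> iso_over g f.
Proof.
intros [u [v [H1 [H2 H3]]]]; exists v, u; repeat split; trivial.
rewrite <- H3, <- comp_assoc, H1; apply comp_idr.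
Qed.

Lemma iso_over_trans (C : Category) (A B D X : C) (f : Hom A X) (g : Hom B X)
    (h : Hom D X) :
  iso_over f g -> iso_over g h -> iso_over f h.
Proof.
intros [u [v [H1 [H2 H3]]]] [u' [v' [H1' [H2' H3']]]].
exists (u' ∘ u), (v ∘ v'); repeat split.
- rewrite comp_assoc, <- (comp_assoc u' u v), H1, comp_idr; trivial.
- rewrite comp_assoc, <- (comp_assoc v v' u'), H2', comp_idr; trivial.
- rewrite comp_assoc, H3'; trivial.
Qed.

Lemma pullback_id (C : Category) (A B X : C) (m : Hom A X) (n : Hom B X) :
  (exists r : Hom B A, is_pullback m (idm X) r n) <-> iso_over n m.
Proof.
split.
- intros [r [H U]].
  destruct (U A (idm A) m) as [t [[T1 T2] _]].
  { rewrite comp_idr, comp_idl; trivial. }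
  rewrite comp_idl in H.
  exists r, t; repeat split; trivial.
  destruct (U B r n) as [s [_ Us]].
  { rewrite comp_idl; trivial. }
  transitivity s; [symmetry|]; apply Us; split; rewrite ?comp_idr; trivial.
  + rewrite comp_assoc, T1, comp_idl; trivial.
  + rewrite comp_assoc, T2; trivial.
- intros [u [v [H1 [H2 H3]]]]; exists u; split.
  { rewrite comp_idl; trivial. }
  intros Y a b Hab; rewrite comp_idl in Hab; subst b.
  exists (v ∘ a); split.
  + split.
    * rewrite comp_assoc, H1, comp_idl; trivial.
    * rewrite <- H3, <- comp_assoc, (comp_assoc u v a), H1, comp_idl; trivial.
  + intros t [<- _]; rewrite comp_assoc, H2, comp_idl; trivial.
Qed.

Lemma pullback_iso (C : Category) (A A' X Y P Q : C) (m : Hom A X)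
    (m' : Hom A' X) (g : Hom Y X) (p : Hom P A) (q : Hom P Y) (p' : Hom Q A')
    (q' : Hom Q Y) :
  iso_over m m' -> is_pullback m g p q -> is_pullback m' g p' q' ->
  iso_over q q'.
Proof.
intros [u [v [H1 [H2 H3]]]] [E U] [E' U'].
assert (H4 : m ∘ v = m').
{ rewrite <- H3, <- comp_assoc, H1; apply comp_idr. }
destruct (U' P (u ∘ p) q) as [s [[S1 S2] _]].
{ rewrite comp_assoc, H3; trivial. }
destruct (U Q (v ∘ p') q') as [t [[T1 T2] _]].
{ rewrite comp_assoc, H4; trivial. }
exists s, t; repeat split; trivial.
- destruct (U' Q p' q' E') as [w [_ W]].
  transitivity w; [symmetry|]; apply W; split; rewrite ?comp_idr; trivial.
  + rewrite comp_assoc, S1, <- comp_assoc, T1, comp_assoc, H1, comp_idl;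
      trivial.
  + rewrite comp_assoc, S2; trivial.
- destruct (U P p q E) as [w [_ W]].
  transitivity w; [symmetry|]; apply W; split; rewrite ?comp_idr; trivial.
  + rewrite comp_assoc, T1, <- comp_assoc, S1, comp_assoc, H2, comp_idl;
      trivial.
  + rewrite comp_assoc, T2; trivial.
Qed.

Lemma pullback_iso_dom (C : Category) (A X Y P Q : C) (m : Hom A X)
    (g : Hom Y X) (p : Hom P A) (q : Hom P Y) (q' : Hom Q Y) :
  is_pullback m g p q -> iso_over q' q ->
  exists p' : Hom Q A, is_pullback m g p' q'.
Proof.
intros [E U] [u [v [H1 [H2 H3]]]]; exists (p ∘ u); split.
{ rewrite comp_assoc, E, <- H3, comp_assoc; trivial. }
intros Z a b Hab; destruct (U Z a b Hab) as [t [[T1 T2] Ut]].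
exists (v ∘ t); split.
- rewrite <- H3, <- !comp_assoc, !(comp_assoc u v t), H1, comp_idl; auto.
- intros t' [K1 K2]; rewrite (Ut (u ∘ t')).
  + rewrite comp_assoc, H2, comp_idl; trivial.
  + rewrite !comp_assoc, H3; auto.
Qed.

Lemma pullback_paste (C : Category) (A X Y Z P Q : C) (m : Hom A X)
    (g : Hom Y X) (h : Hom Z Y) (p : Hom P A) (q : Hom P Y) (p' : Hom Q P)
    (q' : Hom Q Z) :
  is_pullback m g p q -> is_pullback q h p' q' ->
  is_pullback m (g ∘ h) (p ∘ p') q'.
Proof.
intros [E U] [E' U']; split.
{ rewrite comp_assoc, E, <- !comp_assoc, E'; trivial. }
intros W a b Hab.
destruct (U W a (h ∘ b)) as [t [[T1 T2] Ut]].
{ rewrite Hab, comp_assoc; trivial. }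
destruct (U' W t b T2) as [s [[S1 S2] Us]].
exists s; split.
- rewrite <- comp_assoc, S1; auto.
- intros s' [K1 K2]; apply Us; split; trivial.
  symmetry; apply Ut; split.
  + rewrite comp_assoc; trivial.
  + rewrite comp_assoc, E', <- comp_assoc, K2; trivial.
Qed.

(* The class of the pullbacks along [g] of the representatives of [m]. *)
Definition admsub_restr (C : FinLimCategory) (M : AdmissibleClass C) (X Y : C)
    (g : Hom Y X) (m : AdmSub M X) : AdmSub M Y.
Proof.
refine {| represents := fun B n =>
  exists (A : C) (m' : Hom A X), represents m m' /\
    exists p : Hom B A, is_pullback m' g p n |}.
destruct m as [R [A [m [Hm HR]]]]; simpl.
destruct (pullback_exists m g) as [P [p [q Hq]]].
exists P, q; split; [exact (adm_pullback Hm Hq)|].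
intros B n; split.
- intros [A' [m' [Hm' [p' Hp']]]].
  apply HR in Hm'; exact (pullback_iso Hm' Hp' Hq).
- intros Hn; exists A, m; split; [apply HR, iso_over_refl|].
  exact (pullback_iso_dom Hq Hn).
Defined.

Definition sub_psh (C : FinLimCategory) (M : AdmissibleClass C) : Presheaf C.
Proof.
refine {| sec := AdmSub M; restr := @admsub_restr C M |}.
- intros X m; apply admsub_ext; intros B n; simpl.
  destruct m as [R [A [m [Hm HR]]]]; simpl; split.
  + intros [A' [m' [Hm' Hp]]]; apply pullback_id in Hp; apply HR in Hm'.
    apply HR; exact (iso_over_trans Hp Hm').
  + intros Hn; exists A, m; split; [apply HR, iso_over_refl|].
    apply pullback_id, HR, Hn.
- intros X Y Z g h m; apply admsub_ext; intros B n; simpl; split.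
  + intros [A [m' [Hm' [p Hp]]]].
    destruct (pullback_exists m' g) as [P [r [q Hq]]].
    destruct (pullback_exists q h) as [Q [r' [q' Hq']]].
    exists P, q; split; [exists A, m'; eauto|].
    apply (pullback_iso_dom Hq').
    exact (pullback_iso (iso_over_refl m') Hp (pullback_paste Hq Hq')).
  + intros [P [q [[A [m' [Hm' [r Hq]]]] [p Hp]]]].
    exists A, m'; split; trivial.
    exists (r ∘ p); exact (pullback_paste Hq Hp).
Defined.

Lemma slice_prod_comp (C : FinLimCategory) (A B D X : C) (m : Hom A X)
    (h : Hom B X) (k : Hom D B) :
  exists t, m × (h ∘ k) = (m × h) ∘ t.
Proof.
unfold slice_prod.
destruct (chosen_pullback m h) as [P p q [E U]],
  (chosen_pullback m (h ∘ k)) as [P' p' q' [E' U']]; simpl.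
destruct (U P' p' (k ∘ q')) as [t [[T1 _] _]].
{ rewrite comp_assoc; trivial. }
exists t; rewrite <- comp_assoc, T1; trivial.
Qed.

(* [{h | m × h ∈ S}]; the condition is the same for all representatives of
   [m]. *)
Definition act (C : FinLimCategory) (M : AdmissibleClass C) (X : C)
    (S : Omega C X) (m : sub_psh M X) : Omega C X.
Proof.
refine (@Build_Sieve C X (fun B (h : Hom B X) =>
  exists (A : C) (m' : Hom A X), represents m m' /\ mem S (m' × h)) _).
intros B D h k [A [m' [Hm' H]]]; exists A, m'; split; trivial.
destruct (slice_prod_comp m' h k) as [t ->]; apply mem_closed, H.
Defined.

Definition action_preserving (C : FinLimCategory) (M : AdmissibleClass C)
    (phi : PshHom (Omega C) (Omega C)) : Prop :=
  forall (X : C) (S : Omega C X) (m : sub_psh M X),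
    phi X (act S m) = act (phi X S) m.

(* Main.v *)
(* Ordering the arrows into [X] by factorization, the product in C/X is a binary
   meet and a sieve is a down-set. Membership of an iterated product in a sieve
   thus depends only on the set of factors: the order of the factors and their
   repetitions are irrelevant, whence the compatibility with the action and the
   equation [α ⊚ α = α]. *)

Require Import Defs.

Set Implicit Arguments.
Unset Strict Implicit.
Unset Printing Implicit Defensive.

Definition factors (C : Category) (A B X : C) (f : Hom A X) (g : Hom B X)
    : Prop :=
  exists t : Hom A B, f = g ∘ t.

Lemma factors_refl (C : Category) (A X : C) (f : Hom A X) : factors f f.
Proof. exists (idm A); symmetry; apply comp_idr. Qed.

Lemma factors_trans (C : Category) (A B E X : C) (f : Hom A X) (g : Hom B X)
    (h : Hom E X) :
  factors f g -> factors g h -> factors f h.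
Proof.
intros [t ->] [u ->]; exists (u ∘ t); symmetry; apply comp_assoc.
Qed.

Lemma mem_factors (C : Category) (X A B : C) (S : Sieve X) (f : Hom A X)
    (g : Hom B X) :
  factors f g -> mem S g -> mem S f.
Proof. intros [t ->]; apply mem_closed. Qed.

Lemma slice_prod_factors_l (C : FinLimCategory) (A B E X : C) (f : Hom A X)
    (g : Hom B X) (h : Hom E X) :
  factors f h -> factors (f × g) h.
Proof.
apply factors_trans; exists (pb_fst (chosen_pullback f g)); reflexivity.
Qed.

Lemma slice_prod_factors_r (C : FinLimCategory) (A B E X : C) (f : Hom A X)
    (g : Hom B X) (h : Hom E X) :
  factors g h -> factors (f × g) h.
Proof.
apply factors_trans; exists (pb_snd (chosen_pullback f g)).
exact (proj1 (pb_is_pullback (chosen_pullback f g))).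
Qed.

(** A common factorization is a commuting square, so the pullback yields a mediating arrow. With the
    two projection lemmas this makes [f × g] a meet of [f] and [g]. *)
Lemma factors_slice_prod (C : FinLimCategory) (A B E X : C) (f : Hom A X)
    (g : Hom B X) (h : Hom E X) :
  factors h f -> factors h g -> factors h (f × g).
Proof.
intros [a ->] [b Hab].
destruct (proj2 (pb_is_pullback (chosen_pullback f g)) _ a b Hab)
  as [t [[Ht _] _]].
exists t; unfold slice_prod; rewrite <- comp_assoc, Ht; reflexivity.
Qed.

Create HintDb slice.
#[local] Hint Resolve factors_refl factors_slice_prod : slice.
#[local] Hint Resolve slice_prod_factors_l slice_prod_factors_r : slice.

(** Each product factors through the other: [auto] splits the target by the meet property and
    reaches each factor by projections of the source. *)
Lemma mem_slice_prod_left_comm (C : FinLimCategory) (A B E X : C)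
    (S : Sieve X) (f : Hom A X) (g : Hom B X) (h : Hom E X) :
  mem S (f × (g × h)) <-> mem S (g × (f × h)).
Proof. split; apply mem_factors; auto 6 with slice. Qed.

Lemma mem_slice_prod_diag (C : FinLimCategory) (A B X : C)
    (S : Sieve X) (f : Hom A X) (h : Hom B X) :
  mem S (f × (f × h)) <-> mem S (f × h).
Proof. split; apply mem_factors; auto 6 with slice. Qed.

Lemma mem_slice_prod_square (C : FinLimCategory) (A B X : C)
    (S : Sieve X) (f : Hom A X) (h : Hom B X) :
  mem S ((f × f) × h) <-> mem S (f × h).
Proof. split; apply mem_factors; auto 6 with slice. Qed.

(** The component of [α_F] at [X] when [f] is [f_X]. *)
Definition prod_sieve (C : FinLimCategory) (A X : C) (f : Hom A X)
    (S : Sieve X) : Sieve X.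
Proof.
refine {| mem := fun B (h : Hom B X) => mem S (f × h) |}.
intros B E h k; apply mem_factors.
destruct (slice_prod_comp f h k) as [t Ht]; exists t; exact Ht.
Defined.

Theorem theorem4p11 (C : FinLimCategory) (M : AdmissibleClass C)
    (D : C -> C) (f : forall X : C, Hom (D X) X)
    (hf : forall (X Y : C) (g : Hom X Y) (S : Omega C Y) (A : C) (h : Hom A X),
      mem (restr g S) (f X × h) <-> mem S (f Y × (g ∘ h))) :
  exists alpha : PshHom (Omega C) (Omega C),
    (forall (X : C) (S : Omega C X) (A : C) (h : Hom A X),
      mem (alpha X S) h <-> mem S (f X × h)) /\
    action_preserving M alpha /\
    productive_weak_topology alpha /\
    ((forall X : C, slice_idempotent (f X)) -> topology alpha) /\
    (topology alpha ->
      forall (X : C) (S : Omega C X) (A : C) (h : Hom A X),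
        mem (alpha X S) h ->
        (mem S (f X × h) <-> mem S ((f X × f X) × h))).
Proof.
pose (app0 (X : C) (S : Omega C X) := prod_sieve (f X) S : Omega C X).
assert (Hnat : forall (X Y : C) (g : Hom Y X) (S : Omega C X),
  app0 Y (restr g S) = restr g (app0 X S)).
(* With membership unfolded on both sides, naturality is exactly [hf]. *)
{ intros X Y g S; apply sieve_ext; intros A h; exact (hf Y X g S A h). }
pose (alpha := Build_PshHom Hnat).
assert (Htrue : alpha ⊚ psh_true C = psh_true C).
(* Maximal sieves and meets are defined pointwise, hence commute with testing membership at
   [f X × h]. *)
{ apply pshhom_ext; intros X x; apply sieve_ext; simpl; tauto. }
assert (Hmeet : alpha ⊚ psh_meet C = psh_meet C ⊚ psh_prod_map alpha alpha).
{ apply pshhom_ext; intros X x; apply sieve_ext; simpl; tauto. }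
assert (Hidem : alpha ⊚ alpha = alpha).
{ apply pshhom_ext; intros X S; apply sieve_ext; intros A h; simpl.
  (* Applying [alpha] twice tests [f X × (f X × h)], applying it once tests [f X × h]. *)
  apply mem_slice_prod_diag. }
exists alpha; split; [|split; [|split; [|split]]].
- reflexivity.
- intros X S m; apply sieve_ext; intros A h; simpl.
  (* The same representative [m'] serves both sides, which test [m' × (f X × h)] and
     [f X × (m' × h)]. *)
  split; intros [B [m' [Hm H]]]; exists B, m'; split; trivial;
    apply mem_slice_prod_left_comm, H.
- split; [split|]; trivial.
  (* The inequality of a weak topology is one half of [Hmeet]. *)
  rewrite Hmeet; intros X x A h H; exact H.
- intros _; split; [|split]; trivial.
- intros _ X S A h _; symmetry; apply mem_slice_prod_square.
Qed.
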